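(* Let $h:[0,1]\to[0,1]$ be twice continuously differentiable with $h(0)=0$, $h(1)=1$ and $h'(p)>0$. Let $w_0$ be the initial wealth level, $0<p_0<1$ and $0<\varepsilon_1<\min\{p_0,1-p_0\}$. Let $\rho$ be the dual-theory risk premium, i.e. the solution of $$h(p_0)(w_0-1)+(1-h(p_0))(w_0+1)=h(p_0-\varepsilon_1)(w_0-1)+\big(h(p_0+\varepsilon_1)-h(p_0-\varepsilon_1)\big)(w_0-\rho)+(1-h(p_0+\varepsilon_1))(w_0+1),$$ which is given explicitly by $$\rho=\frac{\big(h(p_0)-h(p_0-\varepsilon_1)\big)-\big(h(p_0+\varepsilon_1)-h(p_0)\big)}{h(p_0+\varepsilon_1)-h(p_0-\varepsilon_1)}.$$ Then, approximating $h(p_0\pm\varepsilon_1)$ in this expression by its second-order Taylor expansions around $h(p_0)$ (i.e. up to the order $\varepsilon_1^2$), one obtains the following approximation for the dual-theory risk premium: $$\rho\simeq\frac{\bar{m}_2}{2\,\mathrm{Pr}}\left(-\frac{h''(p_0)}{h'(p_0)}\right),$$ where $\bar{m}_2=2\varepsilon_1^2$ and $\mathrm{Pr}=2\varepsilon_1$ are the unconditional maxiance and the total unconditional probability mass of the risk that, unconditionally, takes the values $\pm1$ each with probability $\varepsilon_1$.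
   Context: Under the dual theory of choice under risk, a risk with cumulative distribution function $F$ is evaluated by $\int x\,\mathrm{d}h(F(x))$, where $h$ is the probability weighting function. The equation for $\rho$ expresses indifference between lottery $A$ (final wealth $w_0-1$ with probability $p_0$, $w_0+1$ with probability $1-p_0$) and lottery $B$ (final wealth $w_0-1$ with probability $p_0-\varepsilon_1$, $w_0+x$ with probability $2\varepsilon_1$, $w_0+1$ with probability $1-p_0-\varepsilon_1$), where $-1<x<1$ and $\rho=0-x$. With $x=0$, lottery $A$ is a mean-preserving spread of $B$, obtained by attaching the zero-mean risk with values $\pm1$ to the intermediate state of $B$. The maxiance (second dual moment about the mean) of a risk $X$ with distribution function $F$ and mean $m$ is $\mathbb{E}[\max(X^{(1)},X^{(2)})]-\mathbb{E}[X]=\int(x-m)\,\mathrm{d}(F(x))^2$, with $X^{(1)},X^{(2)}$ independent copies of $X$; ''unconditional'' means that it is computed with the unconditional probabilities $\varepsilon_1,\varepsilon_1$ of the two values. The unconditional maxiance is considered to be small. The symbol $\simeq$ denotes the approximation resulting from the stated Taylor expansions; no error term is asserted. *)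

(* Defs.v *)
From HB Require Import structures.
From mathcomp Require Import all_boot all_order all_algebra.
From mathcomp Require Import all_classical all_reals all_analysis.
Set Implicit Arguments.
Unset Strict Implicit.
Unset Printing Implicit Defensive.
Import Order.TTheory GRing.Theory Num.Theory.
Import numFieldNormedType.Exports.
Local Open Scope classical_set_scope.
Local Open Scope ring_scope.

(* Differentiation relative to a set A: for A = [0, 1] the derivatives at the
   end points are one-sided and only the values of f on A matter.  In the
   interior of A this is the usual derivative (derive_on_interior below). *)
Definition diff_quot_on (R : realType) (A : set R) (f : R -> R) (x : R) :
    set_system R :=
  (f y - f x) / (y - x) @[y --> within A x^'].

Definition derivable_on (R : realType) (A : set R) (f : R -> R) : Prop :=
  forall x : R, A x -> cvg (diff_quot_on A f x).

Definition derive_on (R : realType) (A : set R) (f : R -> R) (x : R) : R :=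
  lim (diff_quot_on A f x).

Definition derive_onn (R : realType) (A : set R) (n : nat) (f : R -> R) :
    R -> R :=
  iter n (derive_on A) f.

(* f is n times continuously differentiable on A. *)
Definition cont_diff_on (R : realType) (A : set R) (n : nat) (f : R -> R) :
    Prop :=
  (forall k : nat, (k < n)%N -> derivable_on A (derive_onn A k f)) /\
  {within A, continuous (derive_onn A n f)}.

Lemma diff_quot_on_interior (R : realType) (A : set R) (f : R -> R) (x : R) :
  A^° x -> diff_quot_on A f x = (h^-1 *: (f (h + x) - f x) @[h --> 0^']).
Proof.
move=> Ax; rewrite /diff_quot_on.
have -> : within A x^' = x^'.
  rewrite eqEsubset; split => B /= HB; last exact: filterS HB.
  have xA : x^' A by exact: (nbhs_dnbhs (Ax : nbhs x A)).
  have xB : x^' (fun y => A y -> B y) by exact: HB.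
  by apply: (filterS _ (filterI xB xA)) => y [yB /yB].
rewrite eqEsubset; split => B; rewrite /nbhs /= /fmap /dnbhs /= /within /=.
- move=> /nbhs_ballP[e /= e0 xeB]; apply/nbhs_ballP; exists e => //= y.
  rewrite /ball /= sub0r normrN => ye y0.
  have := xeB (y + x); rewrite /ball/= opprD addrCA subrr addr0 normrN.
  rewrite addrK mulrC; apply => //.
  by rewrite -subr_eq0 addrK.
- move=> /nbhs_ballP[e /= e0 xeB]; apply/nbhs_ballP; exists e => //= y.
  rewrite /ball /= => ye yx.
  have := xeB (y - x); rewrite /ball/= sub0r normrN distrC subrK.
  rewrite /GRing.scale /= mulrC; apply => //.
  by rewrite subr_eq0.
Qed.

Lemma derive_on_interior (R : realType) (A : set R) (f : R -> R) (x : R) :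
  A^° x -> derive_on A f x = (f^`() x)%classic.
Proof. by move=> Ax; rewrite /derive_on diff_quot_on_interior. Qed.

(* Taylor polynomial of order n of f around a, evaluated at x. *)
Definition taylor_on (R : realType) (A : set R) (n : nat) (f : R -> R)
    (a x : R) : R :=
  \sum_(k < n.+1) derive_onn A k f a / k`!%:R * (x - a) ^+ k.

(* The explicit risk premium, as a function of the numbers h0, hm, hp standing
   for h(p0), h(p0 - eps), h(p0 + eps) or for approximations of these. *)
Definition dual_premium (R : realType) (h0 hm hp : R) : R :=
  ((h0 - hm) - (hp - h0)) / (hp - hm).

(* Law of the risk taking each of the values -1 and 1 with unconditional
   probability e; its total mass is 2e, not 1. *)
Definition pm1_law (R : realType) (e : {nonneg R}) : set R -> \bar R :=
  measure_add (mscale e (\d_(-1 : R))) (mscale e (\d_(1 : R))).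

HB.instance Definition _ (R : realType) (e : {nonneg R}) :=
  Measure.on (pm1_law e).

Lemma pm1_law_fin_num (R : realType) (e : {nonneg R}) : fin_num_fun (pm1_law e).
Proof.
move=> A mA; rewrite /pm1_law measure_addE /mscale /=.
by rewrite fin_numD !fin_numM// /dirac.
Qed.

HB.instance Definition _ (R : realType) (e : {nonneg R}) :=
  Measure_isFinite.Build _ _ _ (pm1_law e) (@pm1_law_fin_num R e).

(* E[max(X1, X2)] - E[X] with X1, X2 independent copies of X, in terms of the
   law mu of X.  For an unconditional law (of mass possibly less than 1) both
   expectations are taken with the unconditional probabilities; when its mean
   is 0, this is also the integral of x against d(F^2), F(x) = mu ]-oo, x]. *)
Definition maxiance (R : realType) (mu : {finite_measure set R -> \bar R}) : R :=
  \int[(mu \x mu)%E]_z Num.max z.1 z.2 - \int[mu]_x x.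

Definition total_mass (R : realType) (mu : {finite_measure set R -> \bar R}) :
    R :=
  fine (mu setT).

(* Main.v *)
(* The derivative of h is positive on ]0, 1[, so h is strictly increasing there;
   hence h (p0 + eps1) - h (p0 - eps1) <> 0 and the indifference equation, which
   is affine in rho, has the explicit premium as its unique solution.  With the
   Taylor polynomials in place of h (p0 -+ eps1), the numerator of the premium
   is - eps1^2 h''(p0) and its denominator 2 eps1 h'(p0), so the quotient is
   exact.  The maximum of two independent copies of the risk is -1 on one of the
   four atoms of mass eps1^2 and 1 on the other three, and the risk has mean 0:
   its maxiance is 2 eps1^2. *)
Require Import Defs.
From mathcomp Require Import all_boot all_order all_algebra.
From mathcomp Require Import all_classical all_reals all_analysis.
From mathcomp Require Import measurable_realfun ring lra.
Import Order.TTheory GRing.Theory Num.Theory.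
Import numFieldNormedType.Exports.
Local Open Scope classical_set_scope.
Local Open Scope ring_scope.

Lemma ge0_integral_pm1_law (R : realType) (e : {nonneg R}) (f : R -> R) :
  measurable_fun setT f -> (forall x, 0 <= f x) ->
  (\int[pm1_law e]_x (f x)%:E = (e%:num * (f (-1) + f 1))%R%:E)%E.
Proof.
move=> mf f0.
have mEf : measurable_fun setT (EFin \o f) by exact/measurable_EFinP.
rewrite /pm1_law ge0_integral_measure_add//; last by move=> x _; rewrite lee_fin.
rewrite !ge0_integral_mscale//; try by move=> x _; rewrite lee_fin.
by rewrite !integral_dirac// !diracT !mul1e -!EFinM -EFinD mulrDr.
Qed.

(** Both $f^+$ and $f^-$ have finite integrals against two atoms of finite mass, so their difference
    never meets $\infty - \infty$. *)
Lemma integral_pm1_law (R : realType) (e : {nonneg R}) (f : R -> R) :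
  measurable_fun setT f ->
  (\int[pm1_law e]_x (f x)%:E = (e%:num * (f (-1) + f 1))%R%:E)%E.
Proof.
move=> mf; rewrite integralE.
rewrite -/(EFin \o f) funerpos funerneg !ge0_integral_pm1_law//; last 2 first.
- exact: measurable_funrneg.
- exact: measurable_funrpos.
rewrite -EFinB -mulrBr opprD addrACA.
by have fE x : f^\+ x - f^\- x = f x; [rewrite -[in RHS](funrposBneg f)|rewrite !fE].
Qed.

Lemma integral_pm1_law_prod (R : realType) (e : {nonneg R}) (f : R * R -> R) :
  measurable_fun setT f ->
  (\int[pm1_law e \x pm1_law e]_z (f z)%:E =
   (e%:num ^+ 2 * (f (-1, -1) + f (-1, 1) + f (1, -1) + f (1, 1)))%R%:E)%E.
Proof.
move=> mf.
have mEf : measurable_fun setT (EFin \o f) by exact/measurable_EFinP.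
have m1 x := measurable_fun_pair2 x mf; have m2 y := measurable_fun_pair1 y mf.
have n1 x : measurable_fun setT (fun y => `|f (x, y)|) by exact: measurableT_comp.
have n2 y : measurable_fun setT (fun x => `|f (x, y)|) by exact: measurableT_comp.
(* Tonelli's criterion: the iterated integral of $|f|$ is a finite sum over the atoms. Fubini then
   applies to [f] itself. *)
have intf : (pm1_law e \x pm1_law e)%E.-integrable setT (EFin \o f).
  apply/integrable12ltyP => //.
  under eq_integral do rewrite /= (integral_pm1_law _ _ _ (n1 _)).
  rewrite integral_pm1_law ?ltry//.
  by apply: measurable_funM => //; apply: measurable_funD.
rewrite -integral12_prod_meas1// /fubini_F.
under eq_integral do rewrite /= (integral_pm1_law _ _ _ (m1 _)).
rewrite integral_pm1_law; first by congr EFin; ring.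
by apply: measurable_funM => //; apply: measurable_funD.
Qed.

Lemma total_mass_pm1_law (R : realType) (e : {nonneg R}) :
  total_mass (pm1_law e) = 2 * e%:num.
Proof.
have -> : total_mass (pm1_law e) = fine (pm1_law e setT) by [].
by rewrite /pm1_law measure_addE /mscale/= !indicT mulr1 mulr_natl mulr2n.
Qed.

Lemma maxiance_pm1_law (R : realType) (e : {nonneg R}) :
  maxiance (pm1_law e) = 2 * e%:num ^+ 2.
Proof.
rewrite /maxiance /Rintegral integral_pm1_law_prod; last first.
  exact: measurable_maxr.
rewrite integral_pm1_law//= !maxxx.
have N11 : (-1 : R) <= 1 by lra.
rewrite (max_idPr N11) (max_idPl N11); ring.
Qed.

Lemma derive_on_gt0_lt (R : realType) (a b : R) (f : R -> R) :
  derivable_on `[a, b] f ->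
  (forall x, x \in `]a, b[ -> 0 < derive_on `[a, b] f x) ->
  {in `]a, b[ &, {homo f : x y / x < y}}.
Proof.
move=> df df0.
have int x : x \in `]a, b[ -> interior [set` `[a, b]] x.
  by rewrite interior_itv_bnd.
have der x : x \in `]a, b[ -> derivable f x 1.
  move=> xab; have /= := df x (subset_itv_oo_cc xab).
  rewrite (diff_quot_on_interior _ (int x xab)) /derivable.
  (* [derivable] has the increment [h *: 1], hence the factor 1. *)
  by under eq_fun do rewrite -[X in f (X + _)]mulr1.
have f'_gt0 x : x \in `]a, b[ -> 0 < (f^`() x)%classic.
  by move=> xab; rewrite -(derive_on_interior _ (int x xab)) df0.
(* These sides encode the open interval, so continuity at [a] and [b] is not at issue. *)
apply: (gtr0_derive1_lt der f'_gt0 (sa := false) (sb := true)).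
rewrite continuous_open_subspace// => x /set_mem /der dfx.
by apply: differentiable_continuous; apply/derivable1_diffP.
Qed.

(** Pure algebra: the constant and linear terms cancel in the numerator, the constant and quadratic
    ones in the denominator. *)
Lemma dual_premium_taylor (R : realType) (A : set R) (h : R -> R) (p e : R) :
  e != 0 -> derive_on A h p != 0 ->
  dual_premium (h p) (taylor_on A 2 h p (p - e)) (taylor_on A 2 h p (p + e)) =
  e / 2 * - (derive_onn A 2 h p / derive_on A h p).
Proof.
move=> e0 h'0; rewrite /taylor_on !big_ord_recr !big_ord0 /= /dual_premium.
rewrite ![_ + _ - p]addrAC !subrr !add0r.
rewrite fact0 (_ : 1`! = 1)%N// (_ : 2`! = 2)%N// !divr1 !expr0 !expr1 !mulr1.
move: (derive_on A (derive_on A h) p) => h2.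
move: (derive_on A h p) h'0 => h1 h1_neq0.
(* The 4 is the 2 of the denominator [2 * e * h1] times the 2 cleared from [h2 / 2]. *)
field; rewrite h1_neq0/= [X in X != 0](_ : _ = 4 * (h1 * e)); last by ring.
by rewrite !mulf_neq0// pnatr_eq0.
Qed.

Theorem mainTheorem1 (R : realType) (h : R -> R)
    (h01 : forall p : R, p \in `[0, 1] -> h p \in `[0, 1])
    (h_C2 : cont_diff_on `[0, 1] 2 h)
    (h_0 : h 0 = 0) (h_1 : h 1 = 1)
    (dh_gt0 : forall p : R, p \in `[0, 1] -> 0 < derive_on `[0, 1] h p)
    (w0 p0 eps1 : R) (p0_gt0 : 0 < p0) (p0_lt1 : p0 < 1)
    (eps1_gt0 : 0 < eps1) (eps1_lt : eps1 < Num.min p0 (1 - p0)) :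
  let risk := pm1_law (NngNum (ltW eps1_gt0)) in
  let m2 := maxiance risk in
  let Pr := total_mass risk in
  let T := taylor_on `[0, 1] 2 h p0 in
  [/\ forall rho : R,
        h p0 * (w0 - 1) + (1 - h p0) * (w0 + 1) =
        h (p0 - eps1) * (w0 - 1)
          + (h (p0 + eps1) - h (p0 - eps1)) * (w0 - rho)
          + (1 - h (p0 + eps1)) * (w0 + 1)
        <-> rho = dual_premium (h p0) (h (p0 - eps1)) (h (p0 + eps1)),
      dual_premium (h p0) (T (p0 - eps1)) (T (p0 + eps1)) =
        m2 / (2 * Pr) * - (derive_onn `[0, 1] 2 h p0 / derive_on `[0, 1] h p0),
      m2 = 2 * eps1 ^+ 2
    & Pr = 2 * eps1].
Proof.
move=> risk m2 Pr T.
have m2E : m2 = 2 * eps1 ^+ 2 by rewrite /m2 maxiance_pm1_law.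
have PrE : Pr = 2 * eps1 by rewrite /Pr total_mass_pm1_law.
have [eps_p0 eps_1p0] : eps1 < p0 /\ eps1 < 1 - p0.
  by move: eps1_lt; rewrite lt_min => /andP[].
have h_lt : h (p0 - eps1) < h (p0 + eps1).
  apply: (derive_on_gt0_lt _ 0 1); rewrite ?in_itv/=; try lra.
  (* At order 0, [derive_onn] is [h] itself. *)
  - exact: (h_C2.1 0).
  - by move=> x x01; apply: dh_gt0; exact: subset_itv_oo_cc.
have h'_gt0 : 0 < derive_on `[0, 1] h p0.
  by apply: dh_gt0; rewrite in_itv/= !ltW.
split=> //; last first.
  rewrite dual_premium_taylor ?gt_eqF// m2E PrE; congr (_ * _).
  by field; rewrite gt_eqF.
move=> rho; rewrite /dual_premium.
have hB0 : h (p0 + eps1) - h (p0 - eps1) != 0 by rewrite subr_eq0 gt_eqF.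
split=> [E|->]; last by field.
(* The weights on each side of [E] sum to 1, so [w0] cancels and only an equation affine in [rho]
   remains. *)
apply: (mulIf hB0); rewrite divfK//; lra.
Qed.
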